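(* Let $(X,d)$ be a complete metric space, let $k\in\mathbb{N}$, and let $T:\prod_{l=1}^{\infty}X\to X$ be an $H_k$ contraction. Then there exists $u\in X$ such that $T(u,u,u,\ldots)=u$, and for every choice of base points $x_1,\ldots,x_k\in X$ the infinite $k$-Picard sequence with respect to $T$ based on $\{x_1,\ldots,x_k\}$ converges to $u$.
   Context: $\mathbb{N}$ denotes the set of positive integers; metric spaces are nonempty. $\prod_{l=1}^{\infty}X$ is the set of all infinite sequences $(u_i)_{i=1}^{\infty}$ of points of $X$. For $l\in\mathbb{N}$ and points $u_1,\ldots,u_l\in X$, write $(u_{i,\widehat{l}})_{i=1}^{\infty}:=(u_1,u_2,\ldots,u_{l-1},u_l,u_l,u_l,\ldots)$, the infinite tuple in which the $l$-th point is repeated forever. $\mathbb{G}$ denotes the set of all functions $\beta:[0,\infty)\to[0,1)$ such that, for every sequence $(t_n)$ in $[0,\infty)$, $\lim_{n\to\infty}\beta(t_n)=1$ implies $\lim_{n\to\infty}t_n=0$. Extended $M_k$ function: given $T:\prod_{l=1}^{\infty}X\to X$, define $M_k:\prod_{l=1}^{\infty}X\times\prod_{l=1}^{\infty}X\to[0,\infty)$ by $$M_k\big((u_i)_{i=1}^{\infty},(v_i)_{i=1}^{\infty}\big)=\max\Big\{\sup_{l\ge k}d(u_l,v_l),\ \sup_{l\ge k}d\big(u_l,T((u_{i,\widehat{l}})_{i=1}^{\infty})\big),\ \sup_{l\ge k}d\big(v_l,T((v_{i,\widehat{l}})_{i=1}^{\infty})\big)\Big\}$$ if all three suprema exist (are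 finite), and $$M_k\big((u_i)_{i=1}^{\infty},(v_i)_{i=1}^{\infty}\big)=\max\Big\{d(u_k,v_k),\ d\big(u_k,T((u_{i,\widehat{k}})_{i=1}^{\infty})\big),\ d\big(v_k,T((v_{i,\widehat{k}})_{i=1}^{\infty})\big)\Big\}$$ if at least one of them fails to exist. $H_k$ contraction: $T:\prod_{l=1}^{\infty}X\to X$ is an $H_k$ contraction if there is $\beta\in\mathbb{G}$ such that for all $u_1,\ldots,u_k,v_1,\ldots,v_k\in X$, $$d\big(T((u_{i,\widehat{k}})_{i=1}^{\infty}),T((v_{i,\widehat{k}})_{i=1}^{\infty})\big)\le\beta\Big(M_k\big((u_{i,\widehat{k}})_{i=1}^{\infty},(v_{i,\widehat{k}})_{i=1}^{\infty}\big)\Big)\,M_k\big((u_{i,\widehat{k}})_{i=1}^{\infty},(v_{i,\widehat{k}})_{i=1}^{\infty}\big).$$ Infinite $k$-Picard sequence: given $T:\prod_{l=1}^{\infty}X\to X$ and base points $x_1,\ldots,x_k\in X$, it is the sequence defined recursively by $x_{n+k}:=T(x_n,x_{n+1},\ldots,x_{n+k-2},x_{n+k-1},x_{n+k-1},x_{n+k-1},\ldots)$ for all $n\ge1$ (the entry $x_{n+k-1}$ is repeated forever). *)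

(* Defs.v *)
From HB Require Import structures.
From mathcomp Require Import all_boot all_order all_algebra.
From mathcomp Require Import all_classical all_reals all_analysis.

Set Implicit Arguments.
Unset Strict Implicit.
Unset Printing Implicit Defensive.

Import Order.TTheory GRing.Theory Num.Theory.
Import numFieldNormedType.Exports.

Local Open Scope classical_set_scope.
Local Open Scope ring_scope.

(* [Complete] already contains [Pointed], so the spaces are nonempty. *)
#[short(type="completeMetricType")]
HB.structure Definition CompleteMetric (R : numDomainType) :=
  {X of Complete X & Metric R X}.

(* A sequence (u_i)_{i >= 1} is a function [u : nat -> X] with u_i = [u i.-1];
   the numbers [k], [l] below are the 1-based positions of the mathematical
   notation and are only meant to be positive. *)

(* (u_1, ..., u_{l-1}, u_l, u_l, u_l, ...) *)
Definition hat (X : Type) (l : nat) (u : nat -> X) : nat -> X :=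
  fun i => u (minn i l.-1).

(* A function [0, +oo) -> [0, 1) is a function on [R] whose values at negative
   arguments are ignored. *)
Definition classG (R : realType) (beta : R -> R) : Prop :=
  (forall t, 0 <= t -> 0 <= beta t < 1) /\
  (forall t : nat -> R, (forall n, 0 <= t n) ->
     beta (t n) @[n --> \oo] --> (1 : R) -> t n @[n --> \oo] --> (0 : R)).

Definition extM (R : realType) (X : metricType R) (T : (nat -> X) -> X)
    (k : nat) (u v : nat -> X) : R :=
  let duv l := mdist (u l.-1) (v l.-1) in
  let duT l := mdist (u l.-1) (T (hat l u)) in
  let dvT l := mdist (v l.-1) (T (hat l v)) in
  let K := [set l | (k <= l)%N] in
  if `[< [/\ has_sup (duv @` K), has_sup (duT @` K) & has_sup (dvT @` K)] >]
  then Num.max (sup (duv @` K)) (Num.max (sup (duT @` K)) (sup (dvT @` K)))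
  else Num.max (duv k) (Num.max (duT k) (dvT k)).

(* [hat k u] depends only on the first [k] terms of [u], so quantifying over
   sequences amounts to quantifying over u_1, ..., u_k, v_1, ..., v_k. *)
Definition Hcontraction (R : realType) (X : metricType R) (k : nat)
    (T : (nat -> X) -> X) : Prop :=
  exists beta : R -> R, classG beta /\
    forall u v : nat -> X,
      mdist (T (hat k u)) (T (hat k v))
        <= beta (extM T k (hat k u) (hat k v)) * extM T k (hat k u) (hat k v).

Definition picard (X : Type) (k : nat) (T : (nat -> X) -> X) (b : k.-tuple X)
    (x : nat -> X) : Prop :=
  (forall i : 'I_k, x i = tnth b i) /\
  (forall n, x (n + k)%N = T (hat k (fun i => x (n + i)%N))).

Lemma picard_unique (X : Type) (k : nat) (k_gt0 : (0 < k)%N)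
    (T : (nat -> X) -> X) (b : k.-tuple X) (x y : nat -> X) :
  picard T b x -> picard T b y -> x = y.
Proof.
move=> [xb xT] [yb yT]; apply/funext => n.
elim/ltn_ind: n => n IH; have [nk|kn] := ltnP n k.
  by rewrite (xb (Ordinal nk)) (yb (Ordinal nk)).
rewrite -(subnK kn) xT yT; congr T; apply/funext => i; apply: IH.
rewrite -[ltnRHS](subnK kn) ltn_add2l (leq_ltn_trans (geq_minr _ _))//.
by rewrite prednK.
Qed.

Lemma picard_exists (X : Type) (k : nat) (k_gt0 : (0 < k)%N)
    (T : (nat -> X) -> X) (b : k.-tuple X) :
  exists x, picard T b x.
Proof.
(* the state of the iteration is (x_n, ..., x_{n+k-1}, x_{n+k-1}, ...) *)
pose step (w : nat -> X) i := if (i < k.-1)%N then w i.+1 else T w.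
pose w0 i := tnth b (Ordinal (leq_ltn_trans (geq_minr i k.-1)
  (etrans (congr1 (fun m => m <= k)%N (prednK k_gt0)) (leqnn k)))).
pose w n := iter n step w0.
have wE n i : (i <= k.-1)%N -> w n i = w (n + i)%N 0%N.
  elim: i n => [|i IH] n ik; first by rewrite addn0.
  by rewrite addnS -addSn -IH ?(ltnW ik)// /w iterS -/(w n) /step ik.
have w_hat n : hat k (w n) = w n.
  apply/funext => i; rewrite /hat; case: n => [|n].
    by congr tnth; apply: val_inj => /=; rewrite -minnA minnn.
  rewrite /w iterS -/(w n) /step; have [ik|ki] := ltnP i k.-1.
    by rewrite ik.
  by rewrite ltnn.
exists (fun n => w n 0%N); split=> [i|n].
  have ik : (i <= k.-1)%N by rewrite -ltnS prednK.
  rewrite -[nat_of_ord i]add0n -wE//; congr tnth; apply: val_inj => /=.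
  exact/minn_idPl.
have -> : (n + k = n.+1 + k.-1)%N by rewrite addSnnS prednK.
rewrite -wE// /w iterS -/(w n) {1}/step ltnn; congr T.
by rewrite -w_hat; apply/funext => i; rewrite /hat wE// geq_minr.
Qed.

(* Main.v *)
Require Import Defs.
From mathcomp Require Import all_boot all_order all_algebra.
From mathcomp Require Import all_classical all_reals all_analysis.
From mathcomp Require Import lra.

(** On padded tuples the function M_k collapses.  From position [k] on, such a
    tuple is constant and all its truncations coincide with it, so each supremum
    is taken over a single value ([extM_hat]).  Writing [x] for the last point
    u_k and [x'] for the image of the padded tuple, and likewise [y], [y'] for
    the other tuple, the hypothesis becomes
      d(x', y') <= beta(M) M   with   M = max(d(x, y), d(x, x'), d(y, y')).
    Along a Picard sequence the image of a window of length [k] is the last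
    point of the next window, so the last points form an ordinary sequence
    [y n] in which any two steps [y m, y m.+1] and [y n, y n.+1] are related by
    this inequality.  What remains is a fixed point theorem of Geraghty type,
    about one sequence, in which [k] no longer occurs.

    The sequential condition defining the class of [beta] is used through a
    uniform consequence ([classG_gap]): above any positive threshold,
    multiplication by [beta t] lowers [t] by at least a fixed amount delta.
    It gives each stage of the argument without extracting subsequences:
    - the steps d(y n, y n.+1) do not increase, and they would lose delta each
      time if they stayed above a threshold, so they tend to 0;
    - once the steps are below delta / 2, two terms at distance at least eps
      would be moved closer by delta, which two such steps cannot do, so the
      sequence is Cauchy ([contracted_cauchy]);
    - its limit [u] is compared with the constant tuple at [u]; if
      D = d(u, T(u, u, ...)) were positive, M would eventually equal D, so the
      terms would stay within D - delta of T(u, u, ...), whereas their distances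
      to it tend to D ([contracted_limit_fixed]).
    Two fixed points coincide by the same inequality, hence all Picard sequences
    have the same limit. *)

Import Order.TTheory GRing.Theory Num.Theory.
Import numFieldNormedType.Exports.

Local Open Scope classical_set_scope.
Local Open Scope ring_scope.

(** * The comparison functions of class G *)

(** Counterexamples t_n >= eps for the gaps 1 / (n + 1) satisfy
    (1 - beta t_n) eps <= (1 - beta t_n) t_n < 1 / (n + 1); hence beta t_n -> 1,
    and t_n -> 0 by the definition of the class, against t_n >= eps. *)
Lemma classG_gap (R : realType) (beta : R -> R) (eps : R) :
  classG beta -> 0 < eps ->
  exists2 delta, 0 < delta & forall t, eps <= t -> beta t * t <= t - delta.
Proof.
move=> [beta01 betaG] eps0; apply: contrapT => nogap.
have bad n : exists t, eps <= t /\ t - n.+1%:R^-1 < beta t * t.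
  apply: contrapT => no; apply: nogap; exists n.+1%:R^-1.
    by rewrite invr_gt0.
  by move=> t et; rewrite leNgt; apply/negP => lt; apply: no; exists t.
have [t tP] := choice bad.
have t_ge0 n : 0 <= t n by rewrite (le_trans (ltW eps0)) ?(tP n).1.
have inv0 : (n.+1%:R^-1 : R) @[n --> \oo] --> (0 : R) by exact: cvg_harmonic.
have beta1 : beta (t n) @[n --> \oo] --> (1 : R).
  have lo : (1 - n.+1%:R^-1 / eps : R) @[n --> \oo] --> (1 : R).
    rewrite -[X in _ --> X]subr0 -[X in _ --> _ - X](mul0r eps^-1).
    by apply: cvgB; [exact: cvg_cst|apply: cvgMr_tmp].
  apply: (squeeze_cvgr _ lo (@cvg_cst _ _ _ _ _)).
  near=> n; have [et lt] := tP n; have /andP[_ b1] := beta01 _ (t_ge0 n).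
  rewrite (ltW b1) andbT lerBlDr -lerBlDl ler_pdivlMr//.
  apply: (@le_trans _ _ ((1 - beta (t n)) * t n)).
    by rewrite ler_wpM2l// subr_ge0 ltW.
  by rewrite mulrBl mul1r lerBlDl -lerBlDr ltW.
have /cvgrPdist_lt/(_ eps eps0)[N _ /(_ N (leqnn N))] := betaG t t_ge0 beta1.
by rewrite /= sub0r normrN ger0_norm// ltNge (tP N).1.
Unshelve. all: by end_near.
Qed.

(** * The maximum that controls a contraction *)

(** The primed points are to be read as the successors of [x] and [y]. *)
Definition maxdist {R : realType} {X : metricType R} (x x' y y' : X) : R :=
  Num.max (mdist x y) (Num.max (mdist x x') (mdist y y')).

Lemma hat_hat (X : Type) (k l : nat) (u : nat -> X) :
  (k <= l)%N -> hat l (hat k u) = hat k u.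
Proof.
move=> kl; apply/funext => i; rewrite /hat -minnA (@minn_idPr l.-1 k.-1 _)//.
by case: k l kl => [|k] [|l].
Qed.

(** The three suprema are over singletons, so they are finite and the first
    branch of the definition of M_k applies. *)
Lemma extM_hat (R : realType) (X : metricType R) (T : (nat -> X) -> X)
    (k : nat) (u v : nat -> X) :
  extM T k (hat k u) (hat k v) =
  maxdist (u k.-1) (T (hat k u)) (v k.-1) (T (hat k v)).
Proof.
have hatE (w : nat -> X) l : (k <= l)%N -> hat k w l.-1 = w k.-1.
  by move=> kl; rewrite /hat (minn_idPr _)//; case: k l kl => [|?] [|?].
have constE (f : nat -> R) c : (forall l, (k <= l)%N -> f l = c) ->
    f @` [set l | (k <= l)%N] = [set c].
  move=> fc; apply/seteqP; split=> [_ [l kl <-]|_ ->]; first exact: fc.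
  by exists k; [exact: leqnn|exact: fc].
rewrite /extM /maxdist.
rewrite (constE _ (mdist (u k.-1) (v k.-1))); last by move=> l kl; rewrite !hatE.
rewrite (constE _ (mdist (u k.-1) (T (hat k u)))); last first.
  by move=> l kl; rewrite hatE// hat_hat.
rewrite (constE _ (mdist (v k.-1) (T (hat k v)))); last first.
  by move=> l kl; rewrite hatE// hat_hat.
by rewrite !sup1 asboolT.
Qed.

(** * Contractive sequences *)

(** The inequality is stated for four points, without a map, because a point [x]
    does not determine [x']: the latter depends on the whole window ending
    in [x]. *)
Definition contracted {R : realType} {X : metricType R} (beta : R -> R)
    (x x' y y' : X) : Prop :=
  mdist x' y' <= beta (maxdist x x' y y') * maxdist x x' y y'.

Section contraction.
Context {R : realType} {X : metricType R} {beta : R -> R}.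
Context (betaG : classG beta).

Lemma contracted_lt {x x' y y' : X} : contracted beta x x' y y' ->
  0 < maxdist x x' y y' -> mdist x' y' < maxdist x x' y y'.
Proof.
move=> c M0; apply: (le_lt_trans c).
have /andP[_ b1] := betaG.1 _ (ltW M0).
by rewrite gtr_pMl.
Qed.

Lemma contracted_fixed_unique {x y : X} : contracted beta x x y y -> x = y.
Proof.
move=> /contracted_lt c; apply/eqP/negPn; rewrite -mdist_gt0; apply/negP => xy0.
move: c; rewrite /maxdist !mdistxx maxxx (max_l (ltW xy0)) => /(_ xy0).
by rewrite ltxx.
Qed.

(** The successor [u'] of the limit is compared with late terms of the
    sequence, whose steps are small because the sequence converges; the term
    d(u, u') then dominates the maximum. *)
Lemma contracted_limit_fixed {y : nat -> X} {u u' : X} :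
  (forall n, contracted beta (y n) (y n.+1) u u') ->
  y n @[n --> \oo] --> u -> u' = u.
Proof.
move=> c yu; apply/eqP; rewrite eq_sym; apply/negPn; rewrite -mdist_gt0.
apply/negP => D0; have [delta delta0 gap] := classG_gap _ _ _ betaG D0.
(* D / 2 keeps d(y N, u) and, through u, the step at N below D; delta keeps
   y N.+1 too close to u to be within D - delta of u'. *)
have e0 : 0 < Num.min (mdist u u' / 2) delta by rewrite lt_min divr_gt0.
have /metricType_numDomainType.cvgrPdist_lt/(_ _ e0)[N _ near] := yu.
have := near N (leqnn N); rewrite /= lt_min => /andP[dN _].
have := near N.+1 (leqnSn N); rewrite /= lt_min => /andP[dN1 dN1'].
have tri := metric_triangle (y N) u (y N.+1).
have tri' := metric_triangle u (y N.+1) u'.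
have syN := metric_sym u (y N).
have M : maxdist (y N) (y N.+1) u u' = mdist u u'.
  rewrite /maxdist (@max_r _ _ (mdist (y N) (y N.+1))); last lra.
  by rewrite max_r//; lra.
have := c N; rewrite /contracted M.
have := gap _ (lexx (mdist u u')); lra.
Qed.

Section sequence.
Context {y : nat -> X}.
Context (y_contr : forall m n, contracted beta (y m) (y m.+1) (y n) (y n.+1)).

(** If the next step were larger, it would be the maximum M itself and would
    satisfy M < M. *)
Lemma contracted_step_le n :
  mdist (y n.+1) (y n.+2) <= mdist (y n) (y n.+1).
Proof.
rewrite leNgt; apply/negP => lt.
have M : maxdist (y n) (y n.+1) (y n.+1) (y n.+2) = mdist (y n.+1) (y n.+2).
  by rewrite /maxdist !max_r// ltW.
have := contracted_lt (y_contr n n.+1).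
by rewrite M ltxx => /(_ (le_lt_trans (mdist_ge0 _ _) lt)).
Qed.

(** By monotonicity one small step suffices.  Otherwise every step exceeds the
    next one by delta, so the steps decrease linearly and become negative. *)
Lemma contracted_step_small (eps : R) : 0 < eps ->
  exists N, forall n, (N <= n)%N -> mdist (y n) (y n.+1) < eps.
Proof.
move=> eps0; suff [N stepN] : exists N, mdist (y N) (y N.+1) < eps.
  exists N => n /subnK <-; elim: (n - N)%N => [//|m IH].
  exact: le_lt_trans (contracted_step_le _) IH.
apply: contrapT => no; have [delta delta0 gap] := classG_gap _ _ _ betaG eps0.
have ge n : eps <= mdist (y n) (y n.+1).
  by rewrite leNgt; apply/negP => lt; apply: no; exists n.
have drop n : mdist (y n.+1) (y n.+2) <= mdist (y n) (y n.+1) - delta.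
  apply: le_trans (gap _ (ge n)).
  have := y_contr n n.+1; rewrite /contracted /maxdist.
  by rewrite (max_l (contracted_step_le n)) maxxx.
have lin n : mdist (y n) (y n.+1) <= mdist (y 0) (y 1) - n%:R * delta.
  elim: n => [|n IH]; first by rewrite mul0r subr0.
  by rewrite (le_trans (drop n))// -natr1 mulrDl mul1r opprD addrA lerB.
pose n := (Num.truncn (mdist (y 0) (y 1) / delta)).+1.
have : mdist (y 0) (y 1) < n%:R * delta.
  by rewrite -ltr_pdivrMr// truncnS_gt.
have := lin n; have := mdist_ge0 (y n) (y n.+1); lra.
Qed.

(** Steps below eps do not affect a maximum M >= eps, so two late terms at
    distance at least eps get closer by delta after one step; but two steps
    smaller than delta / 2 change a distance by less than delta. *)
Lemma contracted_cauchy : cauchy (y n @[n --> \oo]).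
Proof.
apply: cauchy_exP => eps eps0.
have [delta delta0 gap] := classG_gap _ _ _ betaG eps0.
have e0 : 0 < Num.min eps (delta / 2) by rewrite lt_min eps0 divr_gt0.
have [N small] := contracted_step_small _ e0.
exists (y N), N => // n /= Nn; rewrite ballEmdist/= ltNge; apply/negP => far.
have := small N (leqnn N); rewrite lt_min => /andP[dN dN'].
have := small n Nn; rewrite lt_min => /andP[dn dn'].
have M : maxdist (y N) (y N.+1) (y n) (y n.+1) = mdist (y N) (y n).
  by rewrite /maxdist max_l// ge_max; apply/andP; split; lra.
have := y_contr N n; rewrite /contracted M; have := gap _ far.
have := metric_triangle (y N) (y N.+1) (y n).
have := metric_triangle (y N.+1) (y n.+1) (y n).
have := metric_sym (y n) (y n.+1); lra.
Qed.

End sequence.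
End contraction.

(** * Picard sequences *)

Lemma Hcontraction_contracted (R : realType) (X : metricType R) (k : nat)
    (T : (nat -> X) -> X) : Hcontraction k T ->
  exists2 beta, classG beta & forall u v,
    contracted beta (u k.-1) (T (hat k u)) (v k.-1) (T (hat k v)).
Proof.
move=> [beta [betaG c]]; exists beta => // u v.
by rewrite /contracted -extM_hat; exact: c.
Qed.

Theorem theorem2p1 (R : realType) (X : completeMetricType R) (k : nat)
    (k_gt0 : (0 < k)%N) (T : (nat -> X) -> X) (T_Hk : Hcontraction k T) :
  exists u : X, T (fun _ : nat => u) = u /\
    forall (b : k.-tuple X) (x : nat -> X),
      picard T b x -> x n @[n --> \oo] --> u.
Proof.
have [beta betaG c] := Hcontraction_contracted _ _ _ _ T_Hk.
have to_fixed (b : k.-tuple X) (x : nat -> X) : picard T b x ->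
    exists2 u : X, T (fun=> u) = u & x n @[n --> \oo] --> u.
  (* w n is the window starting at position n, y n its last point *)
  move=> [_ xT]; pose w n : nat -> X := fun i => x (n + i)%N.
  pose y n := x (n + k.-1)%N.
  have yS n : T (hat k (w n)) = y n.+1 by rewrite /y addSnnS prednK// xT.
  have y_contr m n : contracted beta (y m) (y m.+1) (y n) (y n.+1).
    by rewrite -!yS; exact: c.
  have /cauchy_cvgP/cvg_ex[u yu] := contracted_cauchy betaG y_contr.
  exists u; last by move: yu; rewrite /y cvg_shiftn.
  apply: (contracted_limit_fixed betaG _ yu) => n.
  by rewrite -yS; exact: (c (w n) (fun=> u)).
have [x0 x0P] := picard_exists k_gt0 T [tuple of nseq k (point : X)].
have [u uT _] := to_fixed _ _ x0P.
exists u; split=> // b x /to_fixed[v vT xv]; rewrite (_ : u = v)//.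
apply: (contracted_fixed_unique betaG).
by have := c (fun=> u) (fun=> v); rewrite /hat uT vT.
Qed.
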